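(* Let $n\ge3$, $\delta>0$, and let $F\subset C^2([0,1]^{n-2},[0,1]^{n-1})$ be a cinematic family with cinematic constant $K$. Then for any $f,g\in F$ with $\|f-g\|_{C^2([0,1]^{n-2})}\ge\delta$, $$\mathcal{L}^{2n-3}\big[f^\delta([0,1]^{n-2})\cap g^\delta([0,1]^{n-2})\big]\lesssim\frac{\delta^{2n-3}}{\|f-g\|_{C^2([0,1]^{n-2})}^{\,n-2}}.$$
   Context: $\mathcal{L}^{2n-3}$ is Lebesgue measure on $\mathbb{R}^{2n-3}$. For $D\subset[0,1]^{n-2}$, $\eta>0$ and $f:D\to\mathbb{R}^l$, the vertical $\eta$-neighbourhood of the graph is $f^\eta(D)=\{(x,y)\in D\times\mathbb{R}^l:|y-f(x)|<\eta\}$. Cinematic family: a set $F\subset C^2(U,\mathbb{R}^l)$, with $U\subset\mathbb{R}^k$ and $l\ge k$, is a cinematic family of maps with cinematic constant $K$ and doubling constant $D$ if (1) $F$ is contained in a ball of diameter $K$ in the usual $C^2(U,\mathbb{R}^l)$ metric; (2) $F$ is a doubling metric space with doubling constant at most $D$; (3) for all $f,g\in F$, $$\inf_{(x,\xi)\in U\times S^{k-1}}\{|f(x)-g(x)|+|\nabla_\xi f(x)-\nabla_\xi g(x)|\}\ge K^{-1}\|f-g\|_{C^2(U)},$$ where $\nabla_\xi h=\nabla h\cdot\xi$. Here $U=[0,1]^{n-2}$, $k=n-2$, $l=n-1$. The implicit constant in $\lesssim$ may depend on $n$, $K$ and $D$. *)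

(* Defs.v *)
From HB Require Import structures.
From mathcomp Require Import all_boot all_order all_algebra.
From mathcomp Require Import all_classical all_reals all_analysis.

Set Implicit Arguments.
Unset Strict Implicit.
Unset Printing Implicit Defensive.
Import Order.TTheory GRing.Theory Num.Theory.
Import numFieldNormedType.Exports.
Local Open Scope classical_set_scope.
Local Open Scope ring_scope.

(* Euclidean (Frobenius) norm; the library norm `|_| on matrices is the sup
   norm. *)
Definition enorm (R : rcfType) (m n : nat) (A : 'M[R]_(m, n)) : R :=
  Num.sqrt (\sum_i \sum_j A i j ^+ 2).

Definition box (R : realType) (m : nat) (a b : 'rV[R]_m) : set 'rV[R]_m :=
  [set x | forall i, a 0 i <= x 0 i <= b 0 i].

Definition unit_cube (R : realType) (m : nat) : set 'rV[R]_m :=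
  box (const_mx 0) (const_mx 1).

Section Lebesgue.
Context {R : realType} {m : nat}.
Implicit Types (a b : 'rV[R]_m) (A : set 'rV[R]_m).

Definition box_volume a b : R := \prod_i Num.max 0 (b 0 i - a 0 i).

Lemma box_volume_ge0 a b : 0 <= box_volume a b.
Proof. by apply: prodr_ge0 => i _; rewrite le_max lexx. Qed.

(* Lebesgue measure on R^m, as the infimum of the total volume of the
   countable covers by boxes. It is defined on all sets (outer measure) and
   coincides with the product of m copies of the one-dimensional Lebesgue
   measure on Borel sets. The index set D makes finite and empty covers
   available, which matters only when m = 0. *)
Definition lebesgue_rV A : \bar R :=
  ereal_inf [set v | exists (D : set nat) (a b : nat -> 'rV[R]_m),
    A `<=` \bigcup_(k in D) box (a k) (b k) /\
    v = (\esum_(k in D) (box_volume (a k) (b k))%:E)%E].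

Local Open Scope ereal_scope.

Lemma lebesgue_rV_ge0 A : 0 <= lebesgue_rV A.
Proof.
apply: le_ereal_inf_tmp => _ [D [a [b [_ ->]]]].
by apply: esum_ge0 => k _; rewrite lee_fin box_volume_ge0.
Qed.

Lemma lebesgue_rV0 : lebesgue_rV set0 = 0.
Proof.
apply/eqP; rewrite eq_le lebesgue_rV_ge0 andbT.
apply: ereal_inf_lbound; exists set0, (fun=> 0%R), (fun=> 0%R).
by split; [exact: sub0set | rewrite esum_set0].
Qed.

Lemma le_lebesgue_rV : {homo lebesgue_rV : A B / A `<=` B >-> A <= B}.
Proof.
move=> A B AB; apply: ereal_inf_le_tmp => _ [D [a [b [BD ->]]]].
by exists D, a, b; split=> //; apply: subset_trans BD.
Qed.

Lemma lebesgue_rV_sigma_subadditive : sigma_subadditive lebesgue_rV.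
Proof.
move=> A; have [[i ioo]|] := pselect (exists i, lebesgue_rV (A i) = +oo).
  rewrite (eseries_pinfty _ _ ioo) ?leey// => n _.
  by rewrite -ltNye (lt_le_trans _ (lebesgue_rV_ge0 _)).
rewrite -forallNE => Aoo; apply/lee_addgt0Pr => e e0.
apply: le_trans (epsilon_trick _ _ (ltW e0)); last first.
  by move=> n; exact: lebesgue_rV_ge0.
pose P n (c : set nat * (nat -> 'rV[R]_m * 'rV[R]_m)) :=
  A n `<=` \bigcup_(k in c.1) box (c.2 k).1 (c.2 k).2 /\
  \esum_(k in c.1) (box_volume (c.2 k).1 (c.2 k).2)%:E
    <= lebesgue_rV (A n) + (e / (2 ^ n.+1)%:R)%:E.
have [G PG] : {G & forall n, P n (G n)}.
  apply: (@choice _ _ P) => n.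
  have en : (0 < e / (2 ^ n.+1)%:R)%R by rewrite divr_gt0// ltr0n expn_gt0.
  have fin : lebesgue_rV (A n) \is a fin_num.
    by rewrite ge0_fin_numE ?lebesgue_rV_ge0// ltey; apply/eqP/Aoo.
  have [_ [D [a [b [AD ->]]]] /ltW le_v] := lb_ereal_inf_adherent en fin.
  by exists (D, fun k => (a k, b k)).
pose J n := (G n).1; pose Q := setT `*`` J.
pose bx (p : nat * nat) := ((G p.1).2 p.2).
pose h (p : nat * nat) := pickle p.
pose u k := odflt (0, 0)%N (unpickle k) : nat * nat.
have hK p : u (h p) = p by rewrite /u /h pickleK.
have -> : \sum_(i <oo) (lebesgue_rV (A i) + (e / (2 ^ i.+1)%:R)%:E) =
  \esum_(i in setT) (lebesgue_rV (A i) + (e / (2 ^ i.+1)%:R)%:E).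
  rewrite nneseries_esumT// => n.
  by rewrite adde_ge0 ?lebesgue_rV_ge0// lee_fin divr_ge0// ltW.
apply: (@le_trans _ _ (\esum_(i in setT) \esum_(j in J i)
    (box_volume (bx (i, j)).1 (bx (i, j)).2)%:E)); last first.
  by apply: le_esum => i _; exact: (PG i).2.
rewrite (esum_esum (a := fun i j =>
  (box_volume (bx (i, j)).1 (bx (i, j)).2)%:E)); last first.
  by move=> i j _ _; rewrite lee_fin box_volume_ge0.
apply: ereal_inf_lbound.
exists (h @` Q), (fun k => (bx (u k)).1), (fun k => (bx (u k)).2); split.
  move=> x [n _ /(PG n).1 [k Jk xk]].
  by exists (h (n, k)); [exists (n, k) | rewrite hK].
rewrite esum_image; last by move=> p q _ _; exact: (can_inj hK).
by apply: eq_esum => -[i j] _; rewrite hK.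
Qed.

HB.instance Definition _ := isOuterMeasure.Build R 'rV[R]_m lebesgue_rV
  lebesgue_rV0 lebesgue_rV_ge0 le_lebesgue_rV lebesgue_rV_sigma_subadditive.

End Lebesgue.

Section CinematicFamily.
Context {R : realType} {k l : nat}.
Implicit Types (U : set 'rV[R]_k) (f g : 'rV[R]_k -> 'rV[R]_l).

(* Partial derivatives relative to U: the increments are restricted to those
   that stay in U. For U the unit cube, this is the usual partial derivative in
   the interior and the one-sided one at the boundary, and in particular only
   the values of f on U matter. *)
Definition pdiff_quot U (i : 'I_k) f (x : 'rV[R]_k) (h : R) : 'rV[R]_l :=
  h^-1 *: (f (x + h *: delta_mx 0 i) - f x).

Definition incr U (i : 'I_k) (x : 'rV[R]_k) : set R :=
  [set h | U (x + h *: delta_mx 0 i)].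

Definition pderivable U (i : 'I_k) f (x : 'rV[R]_k) : Prop :=
  cvg (pdiff_quot U i f x @ within (incr U i x) 0^').

Definition pderive U (i : 'I_k) f (x : 'rV[R]_k) : 'rV[R]_l :=
  lim (pdiff_quot U i f x @ within (incr U i x) 0^').

Fixpoint contdiff (r : nat) U f : Prop :=
  {within U, continuous f} /\
  if r is r'.+1 then
    forall i, (forall x, U x -> pderivable U i f x) /\
              contdiff r' U (pderive U i f)
  else True.

(* Row i is the i-th partial derivative: vectors act on the left, as for the
   Jacobian 'J of the library. *)
Definition grad U f (x : 'rV[R]_k) : 'M[R]_(k, l) :=
  \matrix_(i < k) pderive U i f x.

Definition dir_derive U (xi : 'rV[R]_k) f (x : 'rV[R]_k) : 'rV[R]_l :=
  xi *m grad U f x.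

Definition hess_norm U f (x : 'rV[R]_k) : R :=
  Num.sqrt (\sum_i \sum_j enorm (pderive U j (pderive U i f) x) ^+ 2).

(* The suprema are meaningful (finite) for f of class C^2 on a nonempty compact
   set U. *)
Definition C2norm U f : R :=
  sup [set enorm (f x) | x in U] +
  sup [set enorm (grad U f x) | x in U] +
  sup [set hess_norm U f x | x in U].

Definition C2dist U f g : R := C2norm U (f \- g).

Definition doubling (T : Type) (d : T -> T -> R) (A : set T) (D : nat) : Prop :=
  forall x (r : R), A x -> 0 < r ->
    exists c : 'I_D -> T, (forall i, A (c i)) /\
      forall y, A y -> d x y <= r -> exists i, d (c i) y <= r / 2.

Definition unit_sphere : set 'rV[R]_k := [set xi | enorm xi = 1].

Record cinematic_family U (K : R) (D : nat)
    (F : set ('rV[R]_k -> 'rV[R]_l)) : Prop := CinematicFamily {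
  cinematic_dim : (k <= l)%N ;
  cinematic_C2 : forall f, F f -> contdiff 2 U f ;
  cinematic_ball : exists f0, contdiff 2 U f0 /\
    forall f, F f -> C2dist U f0 f <= K / 2 ;
  cinematic_doubling : doubling (C2dist U) F D ;
  cinematic_inf : forall f g, F f -> F g ->
    K^-1 * C2dist U f g <=
    inf [set enorm (f p.1 - g p.1) +
             enorm (dir_derive U p.2 f p.1 - dir_derive U p.2 g p.1)
        | p in U `*` unit_sphere] }.

Definition graph_nbhd f (eta : R) (D : set 'rV[R]_k) : set 'rV[R]_(k + l) :=
  [set z | D (lsubmx z) /\ enorm (rsubmx z - f (lsubmx z)) < eta].

End CinematicFamily.

(* Main.v *)
Require Import Defs.
From HB Require Import structures.
From mathcomp Require Import all_boot all_order all_algebra.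
From mathcomp Require Import all_classical all_reals all_analysis.
From mathcomp Require Import zify ring lra.
Import Order.TTheory GRing.Theory Num.Theory.
Import numFieldNormedType.Exports.
Local Open Scope classical_set_scope.
Local Open Scope ring_scope.

                                                                             
                                                                     
                                                                              
                                                                              
                                                                               
                                                                         
                                                                          
                                                                             
                                                                              
                          

(** Write [h = f - g], [M] for its C^2 norm, [d] for delta, [k = n - 2], [l = n - 1]. Over the
    intersection of the two neighbourhoods, every coordinate of [h] is at most [2d] in absolute
    value, so the point is that the set of such base points is small.

    The cinematic condition says that [h] and a directional derivative of [h] cannot both be small:
    where [h] is small against [M/K], every derivative in a unit direction is at least of order
    [M/K]. Second derivatives are at most [M], so at distances below a constant times [1/K] the
    linear part of [h] dominates its Taylor remainder. Two base points [x], [y] that close together,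
    both with small values, thus satisfy [|x - y| M/K <= O(d)]. This is [small_value_separation];
    its Taylor estimate is [dir_derive_remainder], obtained from [unit_cube_MVT].

    The cube is cut into [N^k] cells of side [1/N], with [N] of order [K]. Inside each cell the base
    points have diameter [O(K d / M)], and by [lebesgue_rV_tube] the part of the neighbourhood above
    them has measure [O((K d / M)^k d^l)]. Summing over the cells with [lebesgue_rV_cells] gives the
    bound, as [k + l = 2n - 3]. *)

(** * Covering estimates for the outer Lebesgue measure *)

Lemma le_outer_measure_cover {R : realType} {T : Type} {I : finType}
    (mu : {outer_measure set T -> \bar R}) (F : I -> set T) (A : set T) (v : R) :
  A `<=` \bigcup_i F i -> (forall i, mu (F i) <= v%:E)%E ->
  (mu A <= (#|I|%:R * v)%:E)%E.
Proof.
move=> AF Fv; apply: (@le_trans _ _ (mu (\big[setU/set0]_(i : I) F i))).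
  apply: le_outer_measure => x /AF[i _ Fix].
  by rewrite (bigD1 i)//=; left.
apply: (@le_trans _ _ (\sum_(i : I) v%:E)%E).
  elim/big_ind2 : _ => [|X a Y b Xa Yb|i _]; rewrite ?outer_measure0//.
  exact: (le_trans (outer_measureU2 _ _ _)) (leeD Xa Yb).
by rewrite sumEFin sumr_const mulr_natl.
Qed.

Lemma itv_cell {R : realType} (p : nat) (a s t : R) : (0 < p)%N ->
  a <= t <= a + s *+ p ->
  exists j : 'I_p, a + s *+ j <= t <= a + s *+ j + s.
Proof.
elim: p => // -[_ _|p IH _] /andP[at_ ts].
  by exists ord0; rewrite /= !mulr0n !addr0; apply/andP; split.
have [tp|pt] := leP t (a + s *+ p.+1).
  have [j jt] := IH isT (introT andP (conj at_ tp)).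
  by exists (widen_ord (leqnSn _) j).
by exists ord_max; rewrite /= ltW//= -addrA -mulrSr.
Qed.

Section product_space.
Context {R : realType} {k l : nat}.
Implicit Types (A B : set 'rV[R]_(k + l)) (f : 'rV[R]_k -> 'rV[R]_l).

Definition ldiam_le A (s : R) := forall z w, A z -> A w ->
  forall i, `|lsubmx z 0 i - lsubmx w 0 i| <= s.

(** Only the first [k] coordinates are subdivided. It serves at two scales: the cells of side [1/N]
    of the cube, and the much finer cells on which [f] is nearly constant. *)
Lemma lebesgue_rV_cells A (a : 'rV[R]_k) (s v : R) (p : nat) : (0 < p)%N ->
  (forall z, A z -> forall i, a 0 i <= lsubmx z 0 i <= a 0 i + s *+ p) ->
  (forall B, B `<=` A -> ldiam_le B s -> (lebesgue_rV B <= v%:E)%E) ->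
  (lebesgue_rV A <= ((p ^ k)%:R * v)%:E)%E.
Proof.
move=> p0 Aa Av.
pose F (c : {ffun 'I_k -> 'I_p}) := A `&` [set z | forall i,
  a 0 i + s *+ c i <= lsubmx z 0 i <= a 0 i + s *+ c i + s].
have -> : (p ^ k)%N = #|{ffun 'I_k -> 'I_p}| by rewrite card_ffun !card_ord.
apply: (le_outer_measure_cover _ F) => [z Az|c].
  have /choice[c cP] i := itv_cell _ _ _ _ p0 (Aa z Az i).
  by exists (finfun c) => //; split=> //= i; rewrite ffunE.
apply: Av => [z []//|z w [_ /= zc] [_ /= wc] i].
have /andP[] := zc i; have /andP[] := wc i.
by rewrite ler_norml => ? ? ? ?; apply/andP; split; lra.
Qed.

Lemma le_lebesgue_rV_box m (a b : 'rV[R]_m) (A : set 'rV[R]_m) :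
  A `<=` box a b -> (lebesgue_rV A <= (box_volume a b)%:E)%E.
Proof.
move=> Ab; apply: ereal_inf_lbound.
exists [set 0], (fun=> a), (fun=> b); split.
  by move=> x /Ab ?; exists 0.
by rewrite esum_set1// lee_fin box_volume_ge0.
Qed.

(** On base cells so fine that [f] oscillates by at most [d], the tube lies in a box of sides [2s]
    and [4d]. Refining costs nothing: [p] cells per direction with [p s = 2r] give
    [p^k (2s)^k = (4r)^k], whatever [p] is. *)
Lemma lebesgue_rV_tube (U : set 'rV[R]_k) f (d r : R) A :
  0 < d -> 0 < r ->
  (forall e, 0 < e -> exists2 eta, 0 < eta & forall x y, U x -> U y ->
    (forall i, `|x 0 i - y 0 i| <= eta) -> forall j, `|f x 0 j - f y 0 j| <= e) ->
  ldiam_le A r ->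
  (forall z, A z -> U (lsubmx z) /\
    forall j, `|rsubmx z 0 j - f (lsubmx z) 0 j| <= d) ->
  (lebesgue_rV A <= ((4 * r) ^+ k * (4 * d) ^+ l)%:E)%E.
Proof.
move=> d0 r0 uf rA Af.
have [->|/set0P[z0 Az0]] := eqVneq A set0.
  by rewrite lebesgue_rV0 lee_fin mulr_ge0// exprn_ge0// ltW// mulr_gt0.
have [eta eta0 feta] := uf _ d0.
pose p := (Num.truncn (2 * r / eta)).+1.
have pr : 2 * r / eta < p%:R by exact: truncnS_gt.
have p0 : 0 < p%:R :> R by rewrite ltr0n.
pose s : R := 2 * r / p%:R.
have s0 : 0 < s by rewrite divr_gt0// mulr_gt0.
have seta : s <= eta.
  rewrite /s ler_pdivrMr// -ler_pdivrMl// mulrC; exact: ltW.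
have -> : (4 * r) ^+ k * (4 * d) ^+ l =
    (p ^ k)%:R * ((2 * s) ^+ k * (4 * d) ^+ l).
  rewrite mulrA natrX -exprMn; congr (_ ^+ _ * _).
  by rewrite /s; field; rewrite gt_eqF.
apply: (lebesgue_rV_cells A (lsubmx z0 - const_mx r) s) => //.
  move=> z Az i; have := rA _ _ Az Az0 i; rewrite ler_norml !mxE => /andP[? ?].
  have -> : s *+ p = 2 * r by rewrite -[s *+ p]mulr_natr divfK// gt_eqF.
  by apply/andP; split; lra.
move=> B BA sB.
have [->|/set0P[w0 Bw0]] := eqVneq B set0.
  by rewrite lebesgue_rV0 lee_fin mulr_ge0// exprn_ge0// ltW// mulr_gt0.
set x0 := lsubmx w0.
(* The box is centred over a point of [B]. Its vertical half-width [2d] is [d] for the tube plus [d]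
   for the oscillation of [f]. *)
apply: (@le_trans _ _ (box_volume
   (row_mx (x0 - const_mx s) (f x0 - const_mx (2 * d)))
   (row_mx (x0 + const_mx s) (f x0 + const_mx (2 * d))))%:E).
  apply: le_lebesgue_rV_box => z Bz i.
  have Dc m (u : 'rV[R]_m) c q : (u + const_mx c) 0 q = u 0 q + c by rewrite !mxE.
  have Bc m (u : 'rV[R]_m) c q : (u - const_mx c) 0 q = u 0 q - c by rewrite !mxE.
  rewrite -[z]hsubmxK; case: (split_ordP i) => j ->.
    rewrite !row_mxEl Bc Dc.
    have := sB _ _ Bz Bw0 j; rewrite -/x0 ler_norml => /andP[? ?].
    by apply/andP; split; lra.
  rewrite !row_mxEr Bc Dc; have [Uz /(_ j) zf] := Af _ (BA _ Bz).
  have [Uw _] := Af _ (BA _ Bw0).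
  have := feta _ _ Uz Uw (fun i => le_trans (sB _ _ Bz Bw0 i) seta) j.
  move: zf; rewrite -/x0 !ler_norml => /andP[? ?] /andP[? ?].
  by apply/andP; split; lra.
rewrite lee_fin /box_volume big_split_ord/=.
rewrite (eq_bigr (fun=> 2 * s)); last first.
  move=> i _; rewrite !row_mxEl !mxE max_r; lra.
rewrite [X in _ * X](eq_bigr (fun=> 4 * d)); last first.
  move=> i _; rewrite !row_mxEr !mxE max_r; lra.
by rewrite !prodr_const !card_ord.
Qed.

End product_space.

(** * Calculus on the unit cube with derivatives relative to the cube *)

Section unit_cube_calculus.
Context {R : realType} {k l : nat}.
Local Notation U := (@unit_cube R k).
Implicit Types (f g : 'rV[R]_k -> 'rV[R]_l) (x y : 'rV[R]_k).

Lemma unit_cubeP x : U x <-> forall i, 0 <= x 0 i <= 1.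
Proof. by split=> Ux i; have := Ux i; rewrite !mxE. Qed.

Lemma compact_unit_cube : compact U.
Proof.
have -> : U = [set v | forall i, `[0%R, 1%R]%classic (v ord0 i)].
  by apply/seteqP; split=> x /=; rewrite unit_cubeP => Ux i;
     have := Ux i; rewrite in_itv.
by apply: (@rV_compact R k (fun=> `[0, 1]%classic)) => i; exact: segment_compact.
Qed.

(** Heine-Cantor, through the near-covering form of compactness with [eta] running along [0^'+]. *)
Lemma unit_cube_unif_cont f : {within U, continuous f} ->
  forall e, 0 < e -> exists2 eta, 0 < eta & forall x y, U x -> U y ->
    (forall i, `|x 0 i - y 0 i| <= eta) -> forall j, `|f x 0 j - f y 0 j| <= e.
Proof.
move=> /subspace_continuousP fc e e0.
have := compact_unit_cube.
rewrite compact_near_coveringP -near_covering_withinP.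
pose P eta x := forall y, U y ->
  (forall i, `|x 0 i - y 0 i| <= eta) -> forall j, `|f x 0 j - f y 0 j| <= e.
have e20 : 0 < e / 2 by rewrite divr_gt0.
move=> /(_ R (0^'+) P _) H.
have /filterI /(_ (nbhs_right_gt 0)) : \forall eta \near 0^'+, U `<=` P eta.
  apply: H => x Ux.
  have := fc x Ux _ (nbhsx_ballx (f x) _ e20).
  rewrite /= nbhs_simpl/= => /nbhs_ballP[d /= d0 dU].
  have d20 : 0 < d / 2 by rewrite divr_gt0.
  exists (ball x (d / 2), [set t | t < d / 2]) => /=.
    by split; [exact: nbhsx_ballx|exact: nbhs_right_lt].
  move=> [x' t]/= [[_ xx'] td] Ux' y Uy x'y j.
  have xfx' : ball (f x) (e / 2) (f x').
    by apply: dU => //; split=> // i' i; apply: le_ball (xx' i' i); lra.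
  have xfy : ball (f x) (e / 2) (f y).
    apply: dU => //; split=> // i' i; rewrite ord1.
    have := xx' 0 i; have := x'y i.
    rewrite /ball/= !(ltr_norml, ler_norml) => /andP[? ?] /andP[? ?].
    by apply/andP; split; lra.
  have := xfx'.2 0 j; have := xfy.2 0 j.
  rewrite /ball/= !(ltr_norml, ler_norml) => /andP[? ?] /andP[? ?].
  by apply/andP; split; lra.
by case/filter_ex => eta [/= UP eta0]; exists eta => // x y Ux; exact: UP.
Qed.

Lemma unit_cube_bounded f : {within U, continuous f} ->
  exists B, forall x, U x -> forall j, `|f x 0 j| <= B.
Proof.
move=> fc; have := compact_bounded (continuous_compact fc compact_unit_cube).
move=> [M [_ /(_ (M + 1)) MB]]; exists (M + 1) => x Ux j.
have /= := MB _ (f x); rewrite ltrDl ltr01 => /(_ isT) fM.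
apply: le_trans (fM _); last by exists x.
rewrite [leRHS]/Num.norm/= mx_normrE.
exact: (@le_bigmax _ _ _ 0 (fun ij => `|f x ij.1 ij.2|) (0, j)).
Qed.

(** Lines parallel to an axis are parametrized by the coordinate itself rather than by an increment,
    so that the parameter ranges over [[0, 1]]. *)
Definition upd x (i : 'I_k) (t : R) : 'rV[R]_k :=
  \row_m (if m == i then t else x 0 m).

Lemma upd_unit_cube x i t : U x -> 0 <= t <= 1 -> U (upd x i t).
Proof.
move=> Ux t01; apply/unit_cubeP => m; rewrite mxE; case: ifP => // _.
exact: (unit_cubeP x).1.
Qed.

Lemma upd_add x i t h : upd x i t + h *: delta_mx 0 i = upd x i (t + h).
Proof.
apply/rowP => m; rewrite !mxE eqxx/=.
by case: eqVneq => _; rewrite ?mulr1 ?mulr0 ?addr0.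
Qed.

Lemma upd_id x i : upd x i (x 0 i) = x.
Proof. by apply/rowP => m; rewrite mxE; case: eqP => // ->. Qed.

(** Away from the two faces orthogonal to direction [i], the relative partial derivative is thus the
    ordinary two-sided one. *)
Lemma near_incr x i : U x -> 0 < x 0 i < 1 -> \forall h \near 0^', incr U i x h.
Proof.
move=> Ux /andP[xi0 xi1].
have m0 : 0 < Num.min (x 0 i) (1 - x 0 i) by rewrite lt_min xi0 subr_gt0.
have := @dnbhs0_lt R R _ m0; apply: filterS => h.
rewrite lt_min !ltr_norml => /andP[/andP[? ?] /andP[? ?]].
rewrite /incr/= -(upd_id x i) upd_add; apply: upd_unit_cube => //.
by apply/andP; split; lra.
Qed.

(** Makes relative partial derivatives unique: even on a face, one of the two senses of direction
    [i] points into the cube. *)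
Lemma within_incr_proper x i : U x -> ProperFilter (within (incr U i x) 0^').
Proof.
move=> Ux; split; last exact: within_filter.
move=> /nbhs_ballP[e /= e0] eD.
have /andP[xi0 xi1] := (unit_cubeP x).1 Ux i.
(* A step of length at most [1/2] away from the nearer face stays in the cube. *)
pose d := Num.min (e / 2) (1 / 2).
have d0 : 0 < d by rewrite lt_min !divr_gt0.
have de : d <= e / 2 by rewrite ge_min lexx.
have d1 : d <= 1 / 2 by rewrite ge_min lexx orbT.
have [xi2|xi2] := leP (x 0 i) (1 / 2).
  apply: (eD d).
  - by rewrite /ball/= sub0r normrN gtr0_norm//; lra.
  - by rewrite gt_eqF.
  - rewrite /incr/= -(upd_id x i) upd_add; apply: upd_unit_cube => //.
    by apply/andP; split; lra.
apply: (eD (- d)).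
- by rewrite /ball/= sub0r opprK gtr0_norm//; lra.
- by rewrite lt_eqF// oppr_lt0.
- rewrite /incr/= -(upd_id x i) upd_add; apply: upd_unit_cube => //.
  by apply/andP; split; lra.
Qed.

Lemma pdiff_quot_cvg f x i : pderivable U i f x ->
  pdiff_quot U i f x @ within (incr U i x) 0^' --> pderive U i f x.
Proof. by []. Qed.

Lemma pdiff_quot_ext f g x i : U x -> (forall y, U y -> f y = g y) ->
  pdiff_quot U i f x @ within (incr U i x) 0^' =
  pdiff_quot U i g x @ within (incr U i x) 0^'.
Proof.
move=> Ux fg; apply/seteqP; split=> A;
  apply: (@filterS _ 0^') => h /= hA D; move: (hA D); rewrite /= /pdiff_quot !fg//.
Qed.

Lemma cvg_pdiff_quotB f g x i : U x -> pderivable U i f x -> pderivable U i g x ->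
  pdiff_quot U i (f \- g) x @ within (incr U i x) 0^' -->
    pderive U i f x - pderive U i g x.
Proof.
move=> Ux /pdiff_quot_cvg df /pdiff_quot_cvg dg.
have FF := within_incr_proper _ i Ux.
have -> : pdiff_quot U i (f \- g) x = pdiff_quot U i f x \- pdiff_quot U i g x.
  apply/funext => h; rewrite /pdiff_quot /= -scalerBr; congr (_ *: _).
  by rewrite !opprD addrACA.
exact: cvgB.
Qed.

Lemma pderiveB f g x i : U x -> pderivable U i f x -> pderivable U i g x ->
  pderive U i (f \- g) x = pderive U i f x - pderive U i g x.
Proof.
move=> Ux df dg; have FF := within_incr_proper _ i Ux.
by apply: cvg_lim; [exact: norm_hausdorff|exact: cvg_pdiff_quotB].
Qed.

Lemma contdiff_ext r f g : (forall y, U y -> f y = g y) ->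
  contdiff r U f -> contdiff r U g.
Proof.
elim: r f g => [|r IH] f g fg /= [cf df]; split=> //.
- by apply: subspace_eq_continuous cf => x /set_mem/fg.
- by apply: subspace_eq_continuous cf => x /set_mem/fg.
move=> i; have [pf cdf] := df i; split=> [x Ux|].
  by have := pf x Ux; rewrite /pderivable (pdiff_quot_ext f g).
by apply: IH cdf => x Ux; rewrite /pderive (pdiff_quot_ext f g).
Qed.

Lemma contdiffB r f g : contdiff r U f -> contdiff r U g ->
  contdiff r U (f \- g).
Proof.
have cB f' g' : {within U, continuous f'} -> {within U, continuous g'} ->
    {within U, continuous (f' \- g')}.
  by move=> cf cg x; apply: continuousB; [exact: cf|exact: cg].
elim: r f g => [|r IH] f g /= [cf df] [cg dg]; split=> //; try exact: cB.
move=> i; have [pf cdf] := df i; have [pg cdg] := dg i; split=> [x Ux|].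
  by apply/cvg_ex; eexists; exact: cvg_pdiff_quotB (pf _ Ux) (pg _ Ux).
(* The derivative of the difference is known only on [U], hence the detour through
   [contdiff_ext]. *)
apply: contdiff_ext (IH _ _ cdf cdg) => x Ux.
by rewrite (pderiveB _ _ _ _ Ux (pf _ Ux) (pg _ Ux)).
Qed.

Lemma upd_derive f x i j t : U x -> 0 < t < 1 -> pderivable U i f (upd x i t) ->
  is_derive t 1 (fun s => f (upd x i s) 0 j) (pderive U i f (upd x i t) 0 j).
Proof.
move=> Ux t01 /pdiff_quot_cvg df.
have Ut : U (upd x i t) by apply: upd_unit_cube => //; case/andP: t01 => ? ?; rewrite !ltW.
have xt : 0 < upd x i t 0 i < 1 by rewrite mxE eqxx.
have dj : h^-1 *: (f (upd x i (h *: 1 + t)) 0 j - f (upd x i t) 0 j) @[h --> 0^'] -->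
    pderive U i f (upd x i t) 0 j.
  have ic := near_incr _ _ Ut xt.
  have df0 : pdiff_quot U i f (upd x i t) @ 0^' --> pderive U i f (upd x i t).
    move=> A /df; rewrite /= /within/= => W.
    by apply: filterS2 ic W => h + hA; exact: hA.
  rewrite [X in X @ _ --> _](_ : _ =
      (fun v : 'rV[R]_l => v 0 j) \o pdiff_quot U i f (upd x i t)).
    exact: continuous_cvg (@coord_continuous R 1 l 0 j _) df0.
  apply/funext => h.
  have -> : h *: 1 + t = t + h by rewrite /GRing.scale/= mulr1 addrC.
  by rewrite /= /pdiff_quot upd_add !mxE.
apply: DeriveDef; first exact: cvgP dj.
by apply: cvg_lim dj; exact: norm_hausdorff.
Qed.

Lemma upd_within_cont f x i j a b : U x -> {within U, continuous f} ->
  0 <= a -> b <= 1 ->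
  {within `[a, b], continuous (fun s => f (upd x i s) 0 j)}.
Proof.
move=> Ux /subspace_continuousP fc a0 b1.
apply/subspace_continuousP => t /=; rewrite in_itv/= => /andP[at_ tb].
have Ut : U (upd x i t).
  by apply: upd_unit_cube => //; rewrite (le_trans a0)// (le_trans tb).
have := continuous_cvg _ (@coord_continuous R 1 l 0 j _) (fc _ Ut).
move=> H A /H; rewrite /= /within/= => /nbhs_ballP[e /= e0 eA].
apply/nbhs_ballP; exists e => //= s ts /=; rewrite in_itv/= => /andP[as_ sb].
apply: (eA (upd x i s)).
  split=> // i' m; rewrite !mxE; case: ifP => // _; exact: ballxx.
by apply: upd_unit_cube => //; rewrite (le_trans a0)// (le_trans sb).
Qed.

Lemma coord_MVT1 f x i j s t : U x -> {within U, continuous f} ->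
  (forall y, U y -> pderivable U i f y) -> 0 <= s <= 1 -> 0 <= t <= 1 ->
  exists c, [/\ 0 <= c <= 1, `|c - s| <= `|t - s| &
    f (upd x i t) 0 j - f (upd x i s) 0 j =
    (t - s) * pderive U i f (upd x i c) 0 j].
Proof.
move=> Ux fc fd.
have main a b : 0 <= a -> a <= b -> b <= 1 -> exists2 c, a <= c <= b &
    f (upd x i b) 0 j - f (upd x i a) 0 j =
    (b - a) * pderive U i f (upd x i c) 0 j.
  move=> a0 ab b1.
  have [||c] := @MVT_segment R (fun s => f (upd x i s) 0 j)
      (fun s => pderive U i f (upd x i s) 0 j) a b ab.
  - move=> r; rewrite in_itv/= => /andP[? ?].
    have r01 : 0 < r < 1 by rewrite (le_lt_trans a0)// (lt_le_trans _ b1).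
    apply: upd_derive => //; apply: fd; apply: upd_unit_cube => //.
    by case/andP: r01 => ? ?; rewrite !ltW.
  - exact: upd_within_cont.
  - by rewrite in_itv/= => cab ->; exists c => //; rewrite mulrC.
move=> /andP[s0 s1] /andP[t0 t1].
have [st|/ltW ts] := leP s t.
  have [c /andP[sc ct] E] := main _ _ s0 st t1.
  exists c; split=> //; first by apply/andP; split; lra.
  by rewrite !ger0_norm ?subr_ge0// lerB.
have [c /andP[tc cs] E] := main _ _ t0 ts s1.
exists c; split=> //; first by apply/andP; split; lra.
  by rewrite !ler0_norm ?subr_le0//; lra.
by rewrite -[LHS]opprB E -mulNr opprB.
Qed.

(** Walk from [x] to [y] changing one coordinate at a time, and apply the one-variable theorem on
    each edge. The intermediate points depend on the component [j]; the bound on [w i] keeps them as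
    close to [x] as [y] is, coordinatewise. *)
Lemma unit_cube_MVT f x y j : U x -> U y -> {within U, continuous f} ->
  (forall i z, U z -> pderivable U i f z) ->
  exists w : 'I_k -> 'rV[R]_k,
    (forall i, U (w i) /\ forall m, `|w i 0 m - x 0 m| <= `|y 0 m - x 0 m|) /\
    f y 0 j - f x 0 j = \sum_i (y 0 i - x 0 i) * pderive U i f (w i) 0 j.
Proof.
move=> Ux Uy fc fd.
                                                            
pose z (p : nat) : 'rV[R]_k := \row_m (if (m < p)%N then y 0 m else x 0 m).
have Uz p : U (z p).
  apply/unit_cubeP => m; rewrite mxE.
  by case: ifP => _; [exact: (unit_cubeP y).1|exact: (unit_cubeP x).1].
have zl (i : 'I_k) : z i = upd (z i) i (x 0 i).
  by apply/rowP => m; rewrite !mxE; case: eqP => // ->; rewrite ltnn.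
have zr (i : 'I_k) : z i.+1 = upd (z i) i (y 0 i).
  apply/rowP => m; rewrite !mxE ltnS leq_eqVlt.
  by have [->|mi] := eqVneq m i; rewrite ?eqxx// (inj_eq val_inj) (negbTE mi).
have step (i : 'I_k) : exists c : R, [/\ 0 <= c <= 1,
    `|c - x 0 i| <= `|y 0 i - x 0 i| &
    f (z i.+1) 0 j - f (z i) 0 j =
    (y 0 i - x 0 i) * pderive U i f (upd (z i) i c) 0 j].
  have [c] := coord_MVT1 _ _ i j _ _ (Uz i) fc (fd i)
    ((unit_cubeP x).1 Ux i) ((unit_cubeP y).1 Uy i).
  by rewrite -zr -zl; exists c.
have [c cP] := choice step.
exists (fun i : 'I_k => upd (z i) i (c i)); split=> [i|].
  have [c01 cx _] := cP i; split; first exact: upd_unit_cube.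
  move=> m; rewrite !mxE; have [->//|_] := eqVneq m i.
  by case: ifP => // _; rewrite subrr normr0.
rewrite (eq_bigr (fun i : 'I_k => f (z i.+1) 0 j - f (z i) 0 j)); last first.
  by move=> i _; have [_ _ ->] := cP i.
rewrite -(big_mkord xpredT (fun p => f (z p.+1) 0 j - f (z p) 0 j)).
rewrite telescope_sumr//; congr (f _ 0 j - f _ 0 j); apply/rowP => m.
  by rewrite mxE ltn_ord.
by rewrite mxE ltn0.
Qed.

End unit_cube_calculus.

(** * Comparison of the Euclidean norm with coordinates *)

Section euclidean_norm.
Context {R : rcfType}.

Lemma enorm_ge0 {m n} (A : 'M[R]_(m, n)) : 0 <= enorm A.
Proof. exact: sqrtr_ge0. Qed.

Lemma enorm_sqr {m n} (A : 'M[R]_(m, n)) :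
  enorm A ^+ 2 = \sum_i \sum_j A i j ^+ 2.
Proof.
by rewrite sqr_sqrtr// sumr_ge0// => i _; apply: sumr_ge0 => j _; rewrite sqr_ge0.
Qed.

(** Stated for a bare family so as to apply to both [enorm] and [hess_norm]. *)
Lemma le_sqrt_sum2 {m n} (a : 'I_m -> 'I_n -> R) i j :
  `|a i j| <= Num.sqrt (\sum_i \sum_j a i j ^+ 2).
Proof.
rewrite -sqrtr_sqr ler_wsqrtr// (bigD1 i)//= (bigD1 j)//= -addrA lerDl.
by rewrite addr_ge0// sumr_ge0// => *; rewrite ?sumr_ge0// => *; rewrite sqr_ge0.
Qed.

Lemma le_enorm {m n} (A : 'M[R]_(m, n)) i j : `|A i j| <= enorm A.
Proof. exact: le_sqrt_sum2. Qed.

Lemma enorm_le {l} (v : 'rV[R]_l) (b : R) : 0 <= b ->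
  (forall j, `|v 0 j| <= b) -> enorm v <= l%:R * b.
Proof.
move=> b0 vb; rewrite -[leRHS]ger0_norm ?mulr_ge0// -sqrtr_sqr ler_wsqrtr//.
rewrite big_ord1; apply: (@le_trans _ _ (\sum_(j < l) b ^+ 2)).
  by apply: ler_sum => j _; rewrite -[v 0 j ^+ 2]real_normK ?num_real// lerXn2r// nnegrE.
rewrite sumr_const card_ord -[leLHS]mulr_natl exprMn ler_wpM2r ?sqr_ge0//.
by rewrite -natrX ler_nat; case: (l) => // p; rewrite expnS expn1 leq_pmulr.
Qed.

Lemma enormZ {m n} (c : R) (A : 'M[R]_(m, n)) : enorm (c *: A) = `|c| * enorm A.
Proof.
rewrite -sqrtr_sqr -sqrtrM ?sqr_ge0//; congr Num.sqrt.
rewrite mulr_sumr; apply: eq_bigr => i _; rewrite mulr_sumr.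
by apply: eq_bigr => j _; rewrite mxE exprMn.
Qed.

End euclidean_norm.

(** * Separation of near-zeros of [f - g], and the measure bound *)

Section separation.
Context {R : realType} {k l : nat}.
Local Notation U := (@unit_cube R k).
Implicit Types (f g h : 'rV[R]_k -> 'rV[R]_l).

(** When the supremum does not exist, [sup] takes the default value 0. *)
Lemma sup_image_ge0 (S : set 'rV[R]_k) (u : 'rV[R]_k -> R) :
  (forall x, 0 <= u x) -> 0 <= sup (u @` S).
Proof.
move=> u0; have [[[_ [x Sx _]] ub]|] := pselect (has_sup (u @` S)).
  by apply: le_trans (u0 x) _; apply: ub_le_sup => //; exists x.
by move=> /sup_out ->.
Qed.

(** The supremum of [hess_norm] is a genuine upper bound because the second partial derivatives are
    continuous on a compact set; the other two terms of [C2norm] are nonnegative. *)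
Lemma pderive2_le_C2norm h x i m j : contdiff 2 U h -> U x ->
  `|pderive U m (pderive U i h) x 0 j| <= C2norm U h.
Proof.
move=> [_ hC] Ux.
have /choice[B hB] (p : 'I_k * 'I_k) : exists b, forall x, U x ->
    forall j, `|pderive U p.2 (pderive U p.1 h) x 0 j| <= b.
  have [_ [_ /(_ p.2)[_ [cm _]]]] := hC p.1.
  exact: unit_cube_bounded cm.
have hub : has_ubound (hess_norm U h @` U).
  exists (Num.sqrt (\sum_i \sum_j (l%:R * `|B (i, j)|) ^+ 2)) => _ [y Uy <-].
  apply: ler_wsqrtr; apply: ler_sum => i' _; apply: ler_sum => m' _.
  rewrite lerXn2r ?nnegrE ?enorm_ge0 ?mulr_ge0//; apply: enorm_le => // j'.
  exact: le_trans (hB (i', m') _ Uy _) (ler_norm _).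
apply: le_trans (le_enorm _ _ _) _.
apply: (@le_trans _ _ (hess_norm U h x)).
  rewrite -[leLHS]ger0_norm ?enorm_ge0//.
  exact: (le_sqrt_sum2 (fun i m => enorm (pderive U m (pderive U i h) x))).
apply: (@le_trans _ _ (sup (hess_norm U h @` U))).
  by apply: ub_le_sup => //; exists x.
rewrite lerDr addr_ge0// sup_image_ge0// => y; exact: enorm_ge0.
Qed.

(** Taylor's estimate of order two: the mean value theorem is applied to [h], then to each
    [pderive U i h] between [x] and the intermediate point. Each application contributes a factor
    [k * rho]. *)
Lemma dir_derive_remainder h x y (rho : R) j : contdiff 2 U h -> U x -> U y ->
  (forall m, `|y 0 m - x 0 m| <= rho) ->
  `|h y 0 j - h x 0 j - dir_derive U (y - x) h x 0 j| <=
    k%:R * (rho * (k%:R * (rho * C2norm U h))).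
Proof.
move=> hC Ux Uy yx; have [hc hd] := hC.
have [|w [wP ->]] := unit_cube_MVT h x y j Ux Uy hc.
  by move=> i; have [] := hd i.
rewrite mxE -sumrB; apply: le_trans (ler_norm_sum _ _ _) _.
apply: (@le_trans _ _ (\sum_(i < k) (rho * (k%:R * (rho * C2norm U h)))));
  last by rewrite sumr_const card_ord -[leLHS]mulr_natl.
apply: ler_sum => i _; rewrite !mxE -mulrBr normrM ler_pM//.
have [_ [dc dd]] := hd i; have [Uw wx] := wP i.
have [|w' [wP' ->]] := unit_cube_MVT (pderive U i h) x (w i) j Ux Uw dc.
  by move=> m; have [] := dd m.
apply: le_trans (ler_norm_sum _ _ _) _.
apply: (@le_trans _ _ (\sum_(m < k) (rho * C2norm U h)));
  last by rewrite sumr_const card_ord -[leLHS]mulr_natl.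
apply: ler_sum => m _; rewrite normrM ler_pM//.
  exact: le_trans (wx m) (yx m).
by apply: pderive2_le_C2norm => //; have [] := wP' m.
Qed.

(** With [v = y - x], the derivative of [h] at [x] along [v] is bounded below by the cinematic
    condition and above by [h y - h x] plus the Taylor remainder; the bound on [s] lets the
    remainder be absorbed into the lower bound. *)
Lemma small_value_separation h (K d s : R) : 0 < K -> contdiff 2 U h ->
  0 <= d -> 0 < C2norm U h ->
  (forall x xi, U x -> unit_sphere xi ->
    K^-1 * C2norm U h <= enorm (h x) + enorm (dir_derive U xi h x)) ->
  4 * K * l%:R * k%:R ^+ 2 * s <= 1 ->
  forall x y, U x -> U y -> (forall j, `|h x 0 j| <= 2 * d) ->
    (forall j, `|h y 0 j| <= 2 * d) -> (forall i, `|y 0 i - x 0 i| <= s) ->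
  forall i, `|y 0 i - x 0 i| <= 16 * l%:R * K * d / C2norm U h.
Proof.
set M := C2norm U h => K0 hC d0 M0 hK sK x y Ux Uy hx hy yx i.
have [i0 _ i0P] := @arg_maxP _ _ _ i xpredT (fun m => `|y 0 m - x 0 m|) isT.
set rho := `|y 0 i0 - x 0 i0| in i0P.
apply: (@le_trans _ _ rho); first exact: i0P.
rewrite ler_pdivlMr//.
have [->|rho_neq0] := eqVneq rho 0; first by rewrite mul0r !mulr_ge0// ltW.
have rho0 : 0 < rho by rewrite lt_def rho_neq0 normr_ge0.
have ld0 : 0 <= l%:R * d by rewrite mulr_ge0.
have lKd0 : 0 <= l%:R * K * d by rewrite !mulr_ge0// ltW.
(* For [M] this small the conclusion follows from [rho <= 1]. *)
have [Md|dM] := leP M (4 * (l%:R * K * d)).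
  have rho1 : rho <= 1.
    have /andP[? ?] := (unit_cubeP x).1 Ux i0.
    have /andP[? ?] := (unit_cubeP y).1 Uy i0.
    by rewrite ler_norml; apply/andP; split; lra.
  have : rho * M <= 1 * M by rewrite ler_wpM2r// ltW.
  by move: lKd0 Md; lra.
set a := K^-1 * M.
have MKa : M = K * a by rewrite mulVKf// gt_eqF.
have ad : 4 * (l%:R * d) <= a.
  by rewrite ler_pdivlMl//; move: dM; lra.
set v := y - x.
have rv : rho <= enorm v.
  by have := le_enorm v 0 i0; rewrite /v !mxE.
have v0 : 0 < enorm v by apply: lt_le_trans rv.
have d20 : 0 <= 2 * d by rewrite mulr_ge0.
have lower : rho * (a - l%:R * (2 * d)) <= enorm (dir_derive U v h x).
  have sph : unit_sphere ((enorm v)^-1 *: v).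
    by rewrite /unit_sphere/= enormZ gtr0_norm ?invr_gt0// mulVf// gt_eqF.
  have := hK _ _ Ux sph.
  rewrite /dir_derive -scalemxAl enormZ gtr0_norm ?invr_gt0// -lerBlDl.
  rewrite -/(dir_derive U v h x) ler_pdivlMl// => /(le_trans _); apply.
  have hxd := enorm_le _ _ d20 hx.
  by apply: ler_pM; [exact: ltW | move: ld0 ad; lra | exact: rv | exact: lerB].
have upper : enorm (dir_derive U v h x) <=
    l%:R * (4 * d + k%:R * (rho * (k%:R * (rho * M)))).
  apply: enorm_le => [|j].
    by rewrite addr_ge0 ?mulr_ge0 ?(ltW rho0) ?(ltW M0).
  have := dir_derive_remainder h x y rho j hC Ux Uy (fun m => i0P m isT).
  have := hx j; have := hy j; rewrite -/v -/M !ler_norml.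
  by move=> /andP[? ?] /andP[? ?] /andP[? ?]; apply/andP; split; lra.
have srho : 4 * K * l%:R * k%:R ^+ 2 * rho <= 1.
  apply: le_trans sK; apply: ler_wpM2l; last exact: yx.
  by rewrite !mulr_ge0 ?exprn_ge0// ltW.
have a0 : 0 <= a by rewrite mulr_ge0// ?invr_ge0 ltW.
(* Of [rho * a], at most one half is lost to the value of [h] at [x] ([p1]) and one quarter to the
   remainder ([p2]); the quarter left is at most [4 l d]. *)
have p1 := ler_wpM2l (ltW rho0) ad.
have p2 := ler_wpM2r (mulr_ge0 (ltW rho0) a0) srho.
have p3 : rho * a <= 16 * (l%:R * d).
  have := le_trans lower upper; rewrite MKa; move: p1 p2; lra.
have := ler_wpM2l (ltW K0) p3; rewrite MKa; lra.
Qed.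

Lemma graph_nbhd_setI_le f g (K d : R) (N : nat) : 0 < K -> 0 < d ->
  (0 < l)%N -> (0 < N)%N -> 4 * K * l%:R * k%:R ^+ 2 <= N%:R ->
  contdiff 2 U f -> contdiff 2 U g -> 0 < C2norm U (f \- g) ->
  (forall x xi, U x -> unit_sphere xi ->
    K^-1 * C2norm U (f \- g) <=
    enorm (f x - g x) + enorm (dir_derive U xi f x - dir_derive U xi g x)) ->
  (lebesgue_rV (graph_nbhd f d U `&` graph_nbhd g d U) <=
   ((N ^ k)%:R * ((4 * (16 * l%:R * K * d / C2norm U (f \- g))) ^+ k *
                  (4 * d) ^+ l))%:E)%E.
Proof.
move=> K0 d0 l0 N0 KN fC gC M0 fgK; set M := C2norm _ _ in M0 fgK *.
have hC := contdiffB _ _ _ fC gC.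
have l0R : 0 < l%:R :> R by rewrite ltr0n.
have N0R : 0 < N%:R :> R by rewrite ltr0n.
have hK x xi : U x -> unit_sphere xi ->
    K^-1 * M <= enorm ((f \- g) x) + enorm (dir_derive U xi (f \- g) x).
  move=> Ux sxi; have -> : dir_derive U xi (f \- g) x =
      dir_derive U xi f x - dir_derive U xi g x.
    rewrite /dir_derive -mulmxBr; congr (_ *m _); apply/matrixP => i j.
    rewrite !mxE pderiveB ?mxE//.
      by have [_ /(_ i)[dC _]] := fC; exact: dC.
    by have [_ /(_ i)[dC _]] := gC; exact: dC.
  exact: fgK.
have sN : 4 * K * l%:R * k%:R ^+ 2 * N%:R^-1 <= 1 by rewrite ler_pdivrMr// mul1r.
apply: (lebesgue_rV_cells _ (const_mx 0) N%:R^-1) => //.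
  move=> z [[Uz _] _] i; rewrite -[_ *+ N]mulr_natr mulVf ?gt_eqF// !mxE add0r.
  by have := (unit_cubeP _).1 Uz i; rewrite mxE.
move=> B BA sB; apply: (lebesgue_rV_tube U f) => //.
- by rewrite divr_gt0// !mulr_gt0.
- by apply: unit_cube_unif_cont; case: fC.
(* Both graphs pass within [d] of the same point over this base point. *)
- have hz z : B z -> forall j, `|(f \- g) (lsubmx z) 0 j| <= 2 * d.
    move=> /BA[[_ fz] [_ gz]] j.
    have := le_lt_trans (le_enorm _ 0 j) fz.
    have := le_lt_trans (le_enorm _ 0 j) gz.
    rewrite !mxE !(ltr_norml, ler_norml) => /andP[? ?] /andP[? ?].
    by apply/andP; split; lra.
  move=> z w Bz Bw; have [[Uz _] _] := BA _ Bz; have [[Uw _] _] := BA _ Bw.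
  apply: (small_value_separation (f \- g) K d N%:R^-1) => //;
    by [exact: ltW|exact: hz|exact: sB].
- move=> z /BA[[Uz fz] _]; split=> // j.
  by have := ltW (le_lt_trans (le_enorm _ 0 j) fz); rewrite !mxE.
Qed.

End separation.

Theorem lemma2p8 (R : realType) (n : nat) (K : R) (D : nat) :
  (3 <= n)%N -> 0 < K ->
  exists2 C : R, 0 < C &
    forall (delta : R) (F : set ('rV[R]_(n - 2) -> 'rV[R]_(n - 1))),
      0 < delta ->
      cinematic_family (@unit_cube R (n - 2)) K D F ->
      (forall f, F f ->
         forall x, unit_cube x -> @unit_cube R (n - 1) (f x)) ->
      forall f g, F f -> F g ->
        delta <= C2norm (@unit_cube R (n - 2)) (f \- g) ->
        (lebesgue_rV (graph_nbhd f delta (@unit_cube R (n - 2)) `&`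
                      graph_nbhd g delta (@unit_cube R (n - 2)))
         <= (C * (delta ^+ (2 * n - 3) /
                  C2norm (@unit_cube R (n - 2)) (f \- g) ^+ (n - 2)))%:E)%E.
Proof.
move=> n3 K0; set k := (n - 2)%N; set l := (n - 1)%N.
have nkl : (2 * n - 3 = k + l)%N by rewrite /k /l; lia.
have l0 : (0 < l)%N by rewrite /l; lia.
clearbody k l.
pose N := (Num.truncn (4 * K * l%:R * k%:R ^+ 2)).+1.
have KN : 4 * K * l%:R * k%:R ^+ 2 <= N%:R by apply: ltW; exact: truncnS_gt.
have l0R : 0 < l%:R :> R by rewrite ltr0n.
(* [64 = 4 * 16]: the 16 comes from the separation radius, the 4 from the tube estimate. *)
exists ((N ^ k)%:R * (64 * l%:R * K) ^+ k * 4 ^+ l).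
  by rewrite !mulr_gt0 ?exprn_gt0 ?mulr_gt0 ?ltr0n ?expn_gt0.
move=> d F d0 FK _ f g Ff Fg dM.
have M0 := lt_le_trans d0 dM.
have := @graph_nbhd_setI_le R k l f g K d N K0 d0 l0 isT KN
  (cinematic_C2 FK Ff) (cinematic_C2 FK Fg) M0.
move=> /(_ _)/le_trans; apply=> [x xi Ux sxi|].
  apply: le_trans (cinematic_inf FK Ff Fg) _; apply: ge_inf.
    by exists 0 => _ [p _ <-]; rewrite addr_ge0 ?enorm_ge0.
  by exists (x, xi).
rewrite lee_fin nkl exprD le_eqVlt; apply/orP; left; apply/eqP.
set M := C2norm _ _.
have -> : 4 * (16 * l%:R * K * d / M) = 64 * l%:R * K * d / M by ring.
rewrite !exprMn exprVn; ring.
Qed.
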